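(* Let $d \ge 2$ be an integer and let $p \ge 1$ be a real number. Let $0 \ne \alpha \in \mathbb{C}\mathbb{Z}^d$ and let $0 \ne \beta \in L^p(\mathbb{Z}^d)$. If $p \le \frac{2d}{d-1}$, then $\alpha * \beta \ne 0$.
   Context: For a discrete group $G$, a function $f\colon G\to\mathbb{C}$ is written as a formal sum $\sum_{g\in G} a_g g$ with $a_g=f(g)$. $\mathbb{C}G$ is the set of finitely supported functions, and for real $p\ge 1$, $L^p(G)=\{\sum a_g g : \sum_{g}|a_g|^p<\infty\}$. For $\alpha=\sum a_g g\in L^1(G)$ and $\beta=\sum b_g g\in L^p(G)$, the product is the convolution $\alpha*\beta=\sum_{g\in G}\bigl(\sum_{h\in G}a_{gh^{-1}}b_h\bigr)g$. Here $G=\mathbb{Z}^d$ (written additively). *)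

(* Defs.v *)
From HB Require Import structures.
From mathcomp Require Import all_boot all_order all_algebra.
From mathcomp Require Import all_classical all_reals all_analysis.
From mathcomp.real_closed Require Import complex.

Set Implicit Arguments.
Unset Strict Implicit.
Unset Printing Implicit Defensive.

Import Order.TTheory GRing.Theory Num.Theory.

Local Open Scope classical_set_scope.
Local Open Scope ring_scope.

Definition group_algebra (R : realType) (G : zmodType) : set (G -> R[i]) :=
  [set a | finite_set [set g | a g != 0]].

(* [normc] is the modulus of a complex number as an element of [R] (the norm
   [`|z|] has values in [R[i]], where real powers are not available). *)
Definition Lp (R : realType) (G : zmodType) (p : R) : set (G -> R[i]) :=
  [set b | (\esum_(g in [set: G])
              ((ComplexField.Normc.normc (b g)) `^ p)%:E < +oo)%E].

(* [\sum_(h \in A)] is the finite-support sum, with value 0 when infinitely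
   many terms are nonzero; this never happens for [a] in the group algebra,
   by [finite_convol] below. *)
Definition convol (R : realType) (G : zmodType) (a b : G -> R[i]) : G -> R[i] :=
  fun g => \sum_(h \in [set: G]) a (g - h) * b h.

Lemma finite_convol (R : realType) (G : zmodType) (a b : G -> R[i]) (g : G) :
  group_algebra a -> finite_set [set h | a (g - h) * b h != 0].
Proof.
move=> fa; apply: (sub_finite_set _ (finite_image (fun k => g - k) fa)).
move=> h /= abh; exists (g - h); last by rewrite subKr.
by apply: contraNneq abh => ->; rewrite mul0r.
Qed.

(* Main.v *)
Require Import Defs.
From HB Require Import structures.
From mathcomp Require Import all_boot all_order all_algebra all_solvable all_field.
From mathcomp Require Import all_classical all_reals all_analysis.
From mathcomp.real_closed Require Import complex.
From mathcomp Require Import ring lra zify.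

(** By Hoelder, the bound on [p] makes the mass of [|beta|^2] on the box of
    radius [n] equal to [o(n)].  The key claim is that [alpha * beta = 0] then
    forces [(D alpha) * beta = 0], where [(D alpha)(x) = (x_j + r) alpha(x)]: on
    the Fourier side, a function of so small a growth that is carried by the
    zero set of a polynomial [q] is also killed by the derivatives of [q].
    Subtracting a multiple of [alpha] from [D alpha] removes a point from the
    support, so that by induction [alpha] may be taken to be a single point,
    whence [beta = 0].

    For the claim, multiply [beta] by a [1]-Lipschitz cutoff of height [N] and
    support of radius [2N], giving [U] with [q U] small in [l^2].  After a
    finite Fourier transform in the other coordinates, [q] is a polynomial in
    one variable, and [q' U] is the sum over the roots [a] of [q] of
    [V = (q / (X - a)) U].  Since [(X - a) V = q U], the moduli of the
    coefficients of [V] are almost monotone (in a direction depending on whether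
    [|a| <= 1]), so each one is controlled by an average over [N] neighbours:
    [N |V_n|^2 <= 2 (|V|^2 + N^2 |q U|^2)]. *)

Set Implicit Arguments.
Unset Strict Implicit.
Unset Printing Implicit Defensive.

Import Order.TTheory GRing.Theory Num.Theory.

Local Open Scope ring_scope.

(** * Inequalities for finite sums *)

Lemma ler_sum_subseq (R : numDomainType) (I : eqType) (s t : seq I) (F : I -> R) :
  uniq s -> uniq t -> {subset s <= t} -> (forall i, 0 <= F i) ->
  \sum_(i <- s) F i <= \sum_(i <- t) F i.
Proof.
move=> us ut st F0; rewrite [leRHS](bigID [in s])/= -[X in X + _]big_filter.
rewrite (_ : \sum_(i <- [seq i <- t | i \in s]) F i = \sum_(i <- s) F i); last first.
  apply: perm_big; apply: uniq_perm => //; first exact: filter_uniq.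
  by move=> i; rewrite mem_filter; case: (boolP (i \in s)) => // /st ->.
by rewrite lerDl sumr_ge0.
Qed.

(** Cauchy-Schwarz against the constant $1$: the square is a double sum, and $2|F_i||F_j| \le
    |F_i|^2 + |F_j|^2$. *)
Lemma ler_sqr_sum (C : numFieldType) (I : Type) (s : seq I) (F : I -> C) :
  `|\sum_(i <- s) F i| ^+ 2 <= (size s)%:R * \sum_(i <- s) `|F i| ^+ 2.
Proof.
have h : `|\sum_(i <- s) F i| ^+ 2 <= (\sum_(i <- s) `|F i|) ^+ 2.
  by rewrite lerXn2r ?nnegrE ?sumr_ge0 // ler_norm_sum.
apply: le_trans h _; rewrite -(ler_pM2l (ltr0n _ 2)) expr2 mulr_suml.
apply: (@le_trans _ _ (\sum_(i <- s) \sum_(j <- s) (`|F i| ^+ 2 + `|F j| ^+ 2))).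
  rewrite mulr_sumr ler_sum// => i _; rewrite !mulr_sumr ler_sum// => j _.
  rewrite -subr_ge0 (_ : _ - _ = (`|F i| - `|F j|) ^+ 2); last by ring.
  by rewrite real_exprn_even_ge0 // rpredB ?normr_real.
have -> : \sum_(i <- s) \sum_(j <- s) (`|F i| ^+ 2 + `|F j| ^+ 2) =
    2 * ((size s)%:R * \sum_(i <- s) `|F i| ^+ 2); last by [].
under eq_bigr do rewrite big_split/= big_const_seq count_predT iter_addr_0.
rewrite big_split/= big_const_seq count_predT iter_addr_0 sumrMnl mulr_natl.
by rewrite mulr_natl mulr2n.
Qed.

Lemma sqr_normD (C : numFieldType) (x y : C) :
  `|x + y| ^+ 2 <= 2 * (`|x| ^+ 2 + `|y| ^+ 2).
Proof.
have := ler_sqr_sum [:: x; y] id.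
by rewrite !big_cons !big_nil !addr0.
Qed.

(** * Coefficient norms of polynomials in one variable *)

Section CoefficientNorms.
Variable C : numFieldType.
Implicit Types (p q : {poly C}) (a : C).

Definition sqn p : C := \sum_(i < size p) `|p`_i| ^+ 2.
Definition l1n p : C := \sum_(i < size p) `|p`_i|.

Lemma sqnE p n : (size p <= n)%N -> sqn p = \sum_(i < n) `|p`_i| ^+ 2.
Proof.
move=> pn; rewrite /sqn (big_ord_widen _ (fun i => `|p`_i| ^+ 2) pn).
rewrite big_mkcond; apply: eq_bigr => i _.
by case: ltnP => // ?; rewrite nth_default// normr0 expr0n.
Qed.

Lemma l1nE p n : (size p <= n)%N -> l1n p = \sum_(i < n) `|p`_i|.
Proof.
move=> pn; rewrite /l1n (big_ord_widen _ (fun i => `|p`_i|) pn).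
rewrite big_mkcond; apply: eq_bigr => i _.
by case: ltnP => // ?; rewrite nth_default// normr0.
Qed.

Lemma sqn_ge0 p : 0 <= sqn p.
Proof. by rewrite sumr_ge0 // => i _; rewrite exprn_ge0. Qed.

Lemma l1n_ge0 p : 0 <= l1n p.
Proof. by rewrite sumr_ge0. Qed.

Lemma sum_seq_le_sqn p (s : seq nat) :
  uniq s -> \sum_(i <- s) `|p`_i| ^+ 2 <= sqn p.
Proof.
move=> us; set n := maxn (size p) (\max_(i <- s) i).+1.
rewrite (@sqnE _ n) ?leq_maxl// -(big_mkord xpredT (fun i => `|p`_i| ^+ 2)).
apply: ler_sum_subseq => //; first exact: iota_uniq.
move=> i si; rewrite mem_index_iota /= leq_max ltnS; apply/orP; right.
exact: leq_bigmax_seq.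
Qed.

Lemma sum_seq_le_l1n p (s : seq nat) : uniq s -> \sum_(i <- s) `|p`_i| <= l1n p.
Proof.
move=> us; set n := maxn (size p) (\max_(i <- s) i).+1.
rewrite (@l1nE _ n) ?leq_maxl// -(big_mkord xpredT (fun i => `|p`_i|)).
apply: ler_sum_subseq => //; first exact: iota_uniq.
move=> i si; rewrite mem_index_iota /= leq_max ltnS; apply/orP; right.
exact: leq_bigmax_seq.
Qed.

(* A crude Young inequality: [l^1] norm bounded by number of terms times sup. *)
Lemma sqnM_le p q (S : C) : 0 <= S -> (forall i, `|p`_i| <= S) ->
  sqn (p * q) <= ((size p)%:R * S) ^+ 2 * sqn q.
Proof.
move=> S0 pS; rewrite (@sqnE _ (size p + size q)); last first.
  by rewrite (leq_trans (size_polyMleq _ _))// leq_pred.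
set m := (_ + _)%N.
(* Cauchy-Schwarz over the terms $p_i q_{n-i}$; those with $i > n$ are set to $0$, so that the range
   of $i$ does not depend on $n$. *)
have le1 (n : 'I_m) : `|(p * q)`_n| ^+ 2 <=
    (size p)%:R * \sum_(i < size p) S ^+ 2 * (if (i <= n)%N then `|q`_(n - i)| ^+ 2 else 0).
  have -> : (p * q)`_n = \sum_(i < size p) p`_i * (if (i <= n)%N then q`_(n - i) else 0).
    rewrite coefM (big_ord_widen (maxn n.+1 (size p)) (fun j => p`_j * q`_(n - j))) ?leq_maxl//.
    rewrite [RHS](big_ord_widen (maxn n.+1 (size p)) (fun i => p`_i * (if (i <= n)%N then q`_(n - i) else 0))) ?leq_maxr//.
    rewrite big_mkcond [RHS]big_mkcond; apply: eq_bigr => i _ /=.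
    rewrite ltnS; case: (ltnP i (size p)) => ?.
      by case: ifP => // _; rewrite mulr0.
    by rewrite nth_default// mul0r if_same.
  apply: le_trans (ler_sqr_sum _ _) _.
  rewrite -[size (index_enum _)]/(size (index_enum 'I_(size p))).
  rewrite (_ : size (index_enum _) = size p); last first.
    by rewrite -[RHS]card_ord cardE enumT.
  rewrite ler_wpM2l// ler_sum// => i _; rewrite normrM exprMn ler_pM ?exprn_ge0//.
    by rewrite lerXn2r ?nnegrE.
  by case: ifP => //; rewrite normr0 expr0n.
apply: le_trans (ler_sum _ (fun n _ => le1 n)) _.
rewrite -mulr_sumr exchange_big/=.
have -> : ((size p)%:R * S) ^+ 2 * sqn q = (size p)%:R * \sum_(i < size p) (S ^+ 2 * sqn q).
  by rewrite sumr_const card_ord -mulr_natl; ring.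
rewrite ler_wpM2l// ler_sum// => i _; rewrite -mulr_sumr ler_wpM2l ?exprn_ge0//.
rewrite -big_mkcond/= -(big_mkord (fun n => i <= n)%N (fun n => `|q`_(n - i)| ^+ 2)).
rewrite -big_filter -(big_map (fun n => n - i)%N xpredT (fun k => `|q`_k| ^+ 2)).
apply: sum_seq_le_sqn; rewrite map_inj_in_uniq ?filter_uniq ?iota_uniq//.
move=> a b; rewrite !mem_filter => /andP[ia _] /andP[ib _] /eqP.
by rewrite eqn_sub2rE// => /eqP.
Qed.

End CoefficientNorms.

(** * Division by a linear factor *)

Section LinearFactor.
Variables (C : numClosedFieldType) (a : C) (V : {poly C}).
Let g := ('X - a%:P) * V.

Lemma coef_XsubCM0 : g`_0 = - (a * V`_0).
Proof. by rewrite /g mulrBl coefB coefXM coefCM sub0r. Qed.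

Lemma coef_XsubCMS n : g`_n.+1 = V`_n - a * V`_n.+1.
Proof. by rewrite /g mulrBl coefB coefXM coefCM. Qed.

Lemma coef_down n k : `|a| <= 1 ->
  `|V`_n| <= `|V`_(n + k)| + \sum_(i < k) `|g`_(n.+1 + i)|.
Proof.
move=> a1; elim: k => [|k IHk]; first by rewrite big_ord0 addn0 addr0.
rewrite big_ord_recr/= addrCA addrC (le_trans IHk)// lerD2r addSn coef_XsubCMS addnS.
rewrite -[X in `|X| <= _](subrK (a * V`_(n + k).+1)) (le_trans (ler_normD _ _))//.
by rewrite [leRHS]addrC lerD2l normrM ler_piMl.
Qed.

(** The same recurrence in the other direction: $|V_{n+1}| \le |a V_{n+1}| \le |V_n| +
    |g_{n+1}|$. *)
Lemma coef_up n k : 1 <= `|a| ->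
  `|V`_(n + k)| <= `|V`_n| + \sum_(i < k) `|g`_(n.+1 + i)|.
Proof.
move=> a1; elim: k => [|k IHk]; first by rewrite big_ord0 addn0 addr0.
rewrite big_ord_recr/= addrA addnS addSn coef_XsubCMS.
apply: le_trans (lerD IHk (lexx _)).
rewrite distrC (@le_trans _ _ `|a * V`_(n + k).+1|) ?normrM ?ler_peMl//.
rewrite -normrM -[X in `|X| <= _](subrK V`_(n + k)) addrC.
by rewrite (le_trans (ler_normD _ _)).
Qed.

(** For $|a| \le 1$, climb beyond the degree of $V$, where the coefficient is $0$; otherwise descend
    to $V_0$, where $|V_0| \le |a V_0| = |g_0|$. The bound is uniform in $a$. *)
Lemma coef_le_l1n_XsubCM n : `|V`_n| <= l1n g.
Proof.
have us m k : uniq [seq (m + i)%N | i <- index_iota 0 k].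
  by rewrite map_inj_uniq ?iota_uniq//; exact: addnI.
have win m k : \sum_(i < k) `|g`_(m + i)| <= l1n g.
  rewrite -(big_mkord xpredT (fun i => `|g`_(m + i)|)).
  by rewrite -(big_map _ xpredT (fun i => `|g`_i|)) sum_seq_le_l1n.
case/orP: (real_leVge (normr_real a) (real1 C)) => a1.
  apply: le_trans (coef_down n (size V) a1) _.
  by rewrite nth_default ?leq_addl// normr0 add0r.
apply: le_trans (coef_up 0 n a1) _.
have : `|V`_0| <= `|g`_0| by rewrite coef_XsubCM0 normrN normrM ler_peMl.
move=> /lerD/(_ (lexx _))/le_trans; apply.
by have := win 0 n.+1; rewrite big_ord_recl.
Qed.

(** $V_n$ is compared with the $V_{n+k}$ or the $V_{n-k}$, $k < N$, according to $|a|$, and the sums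
    of $|g|$ in between are bounded by Cauchy-Schwarz. As subtraction is truncated, $N \le n$ keeps
    the indices $n-k$ distinct. *)
Lemma coef_avg_XsubCM n N : (N <= n)%N ->
  N%:R * `|V`_n| ^+ 2 <= 2 * (sqn V + N%:R ^+ 2 * sqn g).
Proof.
move=> Nn.
have win m k : (k <= N)%N ->
    (\sum_(i < k) `|g`_(m + i)|) ^+ 2 <= N%:R * sqn g.
  move=> kN; rewrite -[X in X ^+ 2]ger0_norm ?sumr_ge0//.
  apply: le_trans (ler_sqr_sum _ _) _.
  rewrite [size _](_ : _ = k); last by rewrite -[RHS]card_ord cardE enumT.
  rewrite ler_pM ?ler0n ?sumr_ge0// ?ler_nat//.
  under eq_bigr do rewrite normr_id.
  rewrite -(big_mkord xpredT (fun i => `|g`_(m + i)| ^+ 2)).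
  rewrite -(big_map _ xpredT (fun i => `|g`_i| ^+ 2)) sum_seq_le_sqn//.
  by rewrite map_inj_uniq ?iota_uniq//; exact: addnI.
have avg (f : nat -> nat) : {in gtn N &, injective f} ->
    (forall k, (k < N)%N -> exists m, `|V`_n| <= `|V`_(f k)| + \sum_(i < k) `|g`_(m + i)|) ->
    N%:R * `|V`_n| ^+ 2 <= 2 * (sqn V + N%:R ^+ 2 * sqn g).
  move=> finj h.
  have le1 (k : 'I_N) : `|V`_n| ^+ 2 <= 2 * (`|V`_(f k)| ^+ 2 + N%:R * sqn g).
    have [m hm] := h k (ltn_ord k).
    have sg0 : 0 <= \sum_(i < k) `|g`_(m + i)| by rewrite sumr_ge0.
    apply: (@le_trans _ _ (`|(`|V`_(f k)| + \sum_(i < k) `|g`_(m + i)|)| ^+ 2)).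
      by rewrite lerXn2r ?nnegrE// (le_trans hm)// real_ler_norm// rpredD// ger0_real.
    apply: le_trans (sqr_normD _ _) _; rewrite ler_wpM2l// normr_id lerD2l.
    by rewrite ger0_norm// win// ltnW.
  rewrite -[X in X%:R * _]card_ord mulr_natl -sumr_const.
  apply: le_trans (ler_sum _ (fun k _ => le1 k)) _.
  rewrite -mulr_sumr ler_wpM2l// big_split/= lerD//.
    rewrite -(big_mkord xpredT (fun k => `|V`_(f k)| ^+ 2)).
    rewrite -(big_map _ xpredT (fun i => `|V`_i| ^+ 2)) sum_seq_le_sqn//.
    rewrite map_inj_in_uniq ?iota_uniq// => i j.
    rewrite !mem_index_iota/=; exact: finj.
  by rewrite sumr_const card_ord -[leLHS]mulr_natl mulrA -expr2.
case/orP: (real_leVge (normr_real a) (real1 C)) => a1.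
  apply: (avg (addn n)) => [i j _ _ /addnI//|k _].
  by exists n.+1; exact: coef_down.
apply: (avg (subn n)) => [i j|k kN].
  rewrite !inE => iN jN /eqP; rewrite eqn_sub2lE; first by move/eqP.
    exact: leq_trans (ltnW iN) Nn.
  exact: leq_trans (ltnW jN) Nn.
exists (n - k).+1; rewrite -{1}(@subnK k n); first exact: coef_up.
exact: leq_trans (ltnW kN) Nn.
Qed.

End LinearFactor.

(** * The derivative as a sum over the roots *)

Lemma deriv_prod_XsubC (F : fieldType) (c : F) (rs : seq F) :
  let q := c *: \prod_(z <- rs) ('X - z%:P) in
  q^`() = \sum_(z <- rs) q %/ ('X - z%:P).
Proof.
elim: rs => [|z rs]/=; first by rewrite !big_nil derivZ derivC scaler0.
rewrite big_cons scalerAr; set p := c *: _ => IH.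
rewrite derivM IH derivXsubC mul1r big_cons mulKp ?polyXsubC_eq0//.
congr (_ + _); rewrite mulr_sumr big_seq [RHS]big_seq; apply: eq_bigr => w wrs.
by rewrite divp_mulA// dvdp_XsubCl rootE hornerZ (eqP (_ : root _ w)) ?mulr0// root_prod_XsubC.
Qed.

(** In the outer factor [(size q)%:R ^+ 2], one power comes from Cauchy-Schwarz over the roots, the
    other from their number. The constants see $q$ only through its size and $l^1$ norm, not through
    its roots, so they stay bounded when $q$ varies over the evaluations of a bivariate polynomial
    on the unit circle. *)
Lemma deriv_mul_coef (C : numClosedFieldType) (q U : {poly C}) (n N : nat) :
  (N <= n)%N ->
  N%:R * `|(q^`() * U)`_n| ^+ 2 <=
  2 * (size q)%:R ^+ 2 *
    (((size q)%:R * l1n q) ^+ 2 * sqn U + N%:R ^+ 2 * sqn (q * U)).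
Proof.
move=> Nn; have [-> | q0] := eqVneq q 0.
  by rewrite derivC !mul0r coef0 normr0 !expr0n !mulr0 size_poly0 !expr0n !mulr0 !mul0r.
have [rs qE] := closed_field_poly_normal q.
have szrs : (size rs <= size q)%N.
  by rewrite qE size_scale ?lead_coef_eq0// size_prod_XsubC.
rewrite {1}qE deriv_prod_XsubC -qE mulr_suml coef_sum.
apply: (@le_trans _ _ (N%:R * ((size rs)%:R *
    \sum_(z <- rs) `|((q %/ ('X - z%:P)) * U)`_n| ^+ 2))).
  by rewrite ler_wpM2l// ler_sqr_sum.
set B := _ + _.
have B0 : 0 <= B by rewrite addr_ge0// mulr_ge0// ?sqn_ge0 ?exprn_ge0// mulr_ge0// l1n_ge0.
have le1 z : z \in rs -> N%:R * `|((q %/ ('X - z%:P)) * U)`_n| ^+ 2 <= 2 * B.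
  move=> zrs; have dq : 'X - z%:P %| q.
    by rewrite dvdp_XsubCl qE rootZ ?lead_coef_eq0// root_prod_XsubC.
  have eq1 : ('X - z%:P) * (q %/ ('X - z%:P)) = q by rewrite mulrC divpK.
  apply: le_trans (coef_avg_XsubCM z _ Nn) _.
  rewrite mulrA eq1 ler_wpM2l// lerD2r.
  have := @sqnM_le _ (q %/ ('X - z%:P)) U (l1n q) (l1n_ge0 q).
  have h i : `|(q %/ ('X - z%:P))`_i| <= l1n q.
    by have := coef_le_l1n_XsubCM z (q %/ ('X - z%:P)) i; rewrite eq1.
  move=> /(_ h)/le_trans; apply; rewrite ler_wpM2r ?sqn_ge0//.
  rewrite lerXn2r ?nnegrE ?mulr_ge0// ?l1n_ge0// ler_wpM2r ?l1n_ge0//.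
  by rewrite ler_nat size_divp ?polyXsubC_eq0// leq_subr.
rewrite mulrCA mulr_sumr.
apply: (@le_trans _ _ ((size rs)%:R * ((size rs)%:R * (2 * B)))).
  rewrite ler_wpM2l// [leRHS](_ : _ = \sum_(z <- rs) 2 * B); last first.
    by rewrite big_const_seq count_predT iter_addr_0 mulr_natl.
  by rewrite big_seq [leRHS]big_seq ler_sum.
rewrite mulrA -expr2 mulrCA mulrA ler_wpM2r// ler_wpM2l//.
by rewrite lerXn2r ?nnegrE// ler_nat.
Qed.

(** * Roots of unity and the Parseval identity *)

Lemma prim_root_exists (C : numClosedFieldType) n :
  (0 < n)%N -> exists w : C, n.-primitive_root w.
Proof.
move=> n0; pose p : {poly C} := 'X^n - 1.
have [r Dp] := closed_field_poly_normal p.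
move: Dp; rewrite (monicP _) ?monicXnsubC// scale1r => Dp.
have rn1 : all n.-unity_root r by apply/allP => z; rewrite -root_prod_XsubC -Dp.
have sz_r : (n < (size r).+1)%N.
  by rewrite -(size_prod_XsubC r id) -Dp size_XnsubC.
have [|z] := hasP (has_prim_root n0 rn1 _ sz_r); last by exists z.
by rewrite -separable_prod_XsubC -Dp cyclotomic.separable_Xn_sub_1 // pnatr_eq0 -lt0n.
Qed.

Lemma norm_prim_root (C : numClosedFieldType) n (w : C) :
  n.-primitive_root w -> `|w| = 1.
Proof.
move=> pw; apply/eqP; rewrite -(pexpr_eq1 (prim_order_gt0 pw))//.
by rewrite -normrX (prim_expr_order pw) normr1.
Qed.

(** Orthogonality of the characters $k \mapsto w^{(i-j)k}$; the bound on [size p] keeps distinct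
    exponents distinct modulo $M$. *)
Lemma parseval (C : numClosedFieldType) (M : nat) (w : C) (p : {poly C}) :
  M.-primitive_root w -> (size p <= M)%N ->
  \sum_(k < M) `|p.[w ^+ k]| ^+ 2 = M%:R * sqn p.
Proof.
move=> pw pM; have w1 := norm_prim_root pw.
have wu : w != 0 by rewrite -normr_eq0 w1 oner_eq0.
have wC : w^* = w^-1 by rewrite invC_norm w1 expr1n invr1 mul1r.
have orth (i j : 'I_M) :
    \sum_(k < M) (w ^+ i / w ^+ j) ^+ k = (if i == j then M%:R else 0).
  case: eqVneq => [-> | ij].
    by under eq_bigr do rewrite divff ?expf_neq0// expr1n; rewrite sumr_const card_ord.
  have u1 : w ^+ i / w ^+ j - 1 != 0.
    apply: contra ij; rewrite subr_eq0 => /eqP h.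
    have {h} : w ^+ i = w ^+ j by rewrite -[LHS](divfK (expf_neq0 j wu)) h mul1r.
    by move/eqP; rewrite (eq_prim_root_expr pw) !modn_small//.
  (* Geometric sum: $(u - 1)\sum_{k<M} u^k = u^M - 1 = 0$ for $u = w^i/w^j$. *)
  apply: (mulfI u1); rewrite -subrX1 mulr0 exprMn exprVn -!exprM ![(_ * M)%N]mulnC.
  by rewrite !exprM (prim_expr_order pw) !expr1n invr1 mul1r subrr.
transitivity (\sum_(i < M) \sum_(j < M)
    p`_i * (p`_j)^* * \sum_(k < M) (w ^+ i / w ^+ j) ^+ k).
  transitivity (\sum_(k < M) \sum_(i < M) \sum_(j < M)
      p`_i * (p`_j)^* * (w ^+ i / w ^+ j) ^+ k).
    apply: eq_bigr => k _; rewrite normCK (horner_coef_wide _ pM) rmorph_sum mulr_suml.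
    apply: eq_bigr => i _; rewrite mulr_sumr; apply: eq_bigr => j _.
    rewrite rmorphM !rmorphXn/= wC exprMn !exprVn -!exprM ![(k * _)%N]mulnC.
    by ring.
  rewrite exchange_big; apply: eq_bigr => i _; rewrite exchange_big.
  by apply: eq_bigr => j _; rewrite mulr_sumr.
rewrite (sqnE pM) mulr_sumr; apply: eq_bigr => i _.
rewrite (bigD1 i)//= orth eqxx big1 ?addr0 => [|j ji]; last first.
  by rewrite orth eq_sym (negPf ji) mulr0.
by rewrite normCK mulrC.
Qed.

(** * Polynomials in two variables *)

Section Bivariate.
Variable C : numClosedFieldType.
Implicit Types P Q U : {poly {poly C}}.

Definition sqn2 P : C := \sum_(i < size P) sqn P`_i.
Definition l1n2 P : C := \sum_(i < size P) l1n P`_i.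

Lemma sqn0 : sqn (0 : {poly C}) = 0.
Proof. by rewrite /sqn size_poly0 big_ord0. Qed.

Lemma sqn2_ge0 P : 0 <= sqn2 P.
Proof. by rewrite sumr_ge0 // => i _; rewrite sqn_ge0. Qed.

Lemma l1n2_ge0 P : 0 <= l1n2 P.
Proof. by rewrite sumr_ge0 // => i _; rewrite l1n_ge0. Qed.

(** The inner variable is evaluated; the outer one, which is differentiated, remains. *)
Definition evalY (y : C) : {poly {poly C}} -> {poly C} := map_poly (horner_eval y).

HB.instance Definition _ y := GRing.RMorphism.copy (evalY y) (map_poly (horner_eval y)).

Lemma coef_evalY y P i : (evalY y P)`_i = (P`_i).[y].
Proof. by rewrite coef_map. Qed.

Lemma size_evalY y P : (size (evalY y P) <= size P)%N.
Proof. exact: size_poly. Qed.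

Lemma l1n_evalY y P : `|y| = 1 -> l1n (evalY y P) <= l1n2 P.
Proof.
move=> y1; rewrite (l1nE (size_evalY y P)) ler_sum// => i _.
rewrite coef_evalY horner_coef (le_trans (ler_norm_sum _ _ _))// ler_sum// => j _.
by rewrite normrM normrX y1 expr1n mulr1.
Qed.

Lemma sum_sqn_evalY M (w : C) P : M.-primitive_root w ->
  (forall i, (size (P`_i)%R <= M)%N) ->
  \sum_(k < M) sqn (evalY (w ^+ k) P) = M%:R * sqn2 P.
Proof.
move=> pw PM; under eq_bigr do rewrite (sqnE (size_evalY _ P)).
rewrite exchange_big mulr_sumr; apply: eq_bigr => i _.
by rewrite -(parseval pw (PM i)); apply: eq_bigr => k _; rewrite coef_evalY.
Qed.

Lemma size_coef_bound P : exists M, forall i, (size (P`_i)%R <= M)%N.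
Proof.
exists (\max_(i < size P) size (P`_i)%R) => i; case: (ltnP i (size P)) => iP.
  exact: (@leq_bigmax_cond _ predT (fun i : 'I_(size P) => size (P`_i)%R) (Ordinal iP)).
by rewrite nth_default// size_poly0.
Qed.

(* The constants do not depend on the degree in the inner variable: it is
   evaluated at roots of unity, and [parseval] sums the one-variable bounds. *)
Lemma deriv_mul_coef2 Q U (n N : nat) : (N <= n)%N ->
  N%:R * sqn (Q^`() * U)`_n <=
  2 * (size Q)%:R ^+ 2 *
    (((size Q)%:R * l1n2 Q) ^+ 2 * sqn2 U + N%:R ^+ 2 * sqn2 (Q * U)).
Proof.
move=> Nn; have [M1 h1] := size_coef_bound (Q^`() * U).
have [M2 h2] := size_coef_bound U; have [M3 h3] := size_coef_bound (Q * U).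
(* [M] bounds the inner sizes of all three polynomials, as Parseval requires; the successor makes it
   positive. *)
pose M := (M1 + M2 + M3).+1.
have [w pw] := @prim_root_exists C M isT.
have w1 k : `|w ^+ k| = 1 by rewrite normrX (norm_prim_root pw) expr1n.
rewrite -(ler_pM2l (ltr0Sn _ (M1 + M2 + M3))) -/M.
rewrite mulrCA -(parseval pw); last first.
  by have := h1 n; rewrite /M; lia.
rewrite mulrCA mulrDr !(mulrCA M%:R) -!(sum_sqn_evalY pw); first last.
- by move=> i; have := h2 i; rewrite /M; lia.
- by move=> i; have := h3 i; rewrite /M; lia.
rewrite [N%:R * _]mulr_sumr [((size Q)%:R * _) ^+ 2 * _]mulr_sumr [N%:R ^+ 2 * _]mulr_sumr.
rewrite -big_split/= mulr_sumr ler_sum// => k _.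
rewrite -coef_evalY rmorphM/= rmorphM/= -[evalY _ Q^`()](deriv_map).
apply: le_trans (deriv_mul_coef _ _ Nn) _; rewrite -/(evalY _ _).
rewrite ler_pM ?mulr_ge0 ?addr_ge0 ?exprn_ge0 ?mulr_ge0 ?exprn_ge0 ?mulr_ge0 ?sqn_ge0 ?l1n_ge0//.
  by rewrite ler_wpM2l// lerXn2r ?nnegrE// ler_nat size_evalY.
rewrite lerD2r ler_wpM2r ?sqn_ge0// lerXn2r ?nnegrE ?mulr_ge0 ?l1n_ge0 ?l1n2_ge0//.
by rewrite ler_pM ?l1n_ge0// ?ler_nat ?size_evalY// l1n_evalY.
Qed.

End Bivariate.

(** * Boxes in $\mathbb{Z}^d$ and Kronecker substitution *)

Lemma digits_inj d L (a b : 'I_d -> nat) :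
  (forall i, (a i < L)%N) -> (forall i, (b i < L)%N) ->
  (\sum_i a i * L ^ i = \sum_i b i * L ^ i)%N -> a =1 b.
Proof.
elim: d a b => [|d IHd] a b aL bL; first by move=> _ [].
have L0 : (0 < L)%N := leq_ltn_trans (leq0n _) (aL ord0).
have split_sum (c : 'I_d.+1 -> nat) :
    (\sum_i c i * L ^ i = (\sum_(i < d) c (lift ord0 i) * L ^ i) * L + c ord0)%N.
  rewrite big_ord_recl muln1 addnC big_distrl/=; congr (_ + _)%N.
  by apply: eq_bigr => i _; rewrite /bump leq0n add1n expnSr mulnA.
rewrite !split_sum => ab.
have eq0 : a ord0 = b ord0.
  by move/(congr1 (modn^~ L)): ab; rewrite !modnMDl !modn_small.
move: ab; rewrite eq0 => /eqP; rewrite eqn_add2r eqn_pmul2r// => /eqP.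
by move=> /IHd h i; case: (unliftP ord0 i) => [k ->|->//]; rewrite h.
Qed.

Lemma big_seq_sub (V : nmodType) (I : eqType) (s t : seq I) (F : I -> V) :
  uniq s -> uniq t -> {subset s <= t} ->
  {in t, forall i, i \notin s -> F i = 0} ->
  \sum_(i <- t) F i = \sum_(i <- s) F i.
Proof.
move=> us ut st F0; rewrite (bigID [in s])/= [X in _ + X]big1_seq ?addr0; last first.
  by move=> i /andP[is0 it]; exact: F0.
rewrite -big_filter; apply: perm_big; apply: uniq_perm => //.
  exact: filter_uniq.
by move=> i; rewrite mem_filter; case: (boolP (i \in s)) => // /st ->.
Qed.

(** Only an inequality, because the pair [(n0, m0)] may lie outside the ranges. *)
Lemma sum_single_le (R : numDomainType) (n m n0 m0 : nat) (c : R) : 0 <= c ->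
  \sum_(i < n) \sum_(k < m) (if (n0 == i) && (m0 == k) then c else 0) <= c.
Proof.
move=> c0; have [n0n|n0n] := ltnP n0 n; last first.
  rewrite big1// => i _; rewrite big1// => k _.
  by rewrite gtn_eqF// (leq_trans (ltn_ord i)).
rewrite (bigD1 (Ordinal n0n))//= [X in _ + X]big1 ?addr0 => [|i]; last first.
  by rewrite -val_eqE/= eq_sym => /negPf ne; rewrite big1// => k _; rewrite ne.
have [m0m|m0m] := ltnP m0 m; last first.
  rewrite big1// => k _.
  by rewrite [X in _ && X]gtn_eqF ?andbF// (leq_trans (ltn_ord k)).
rewrite (bigD1 (Ordinal m0m))//= !eqxx/= big1 ?addr0// => k.
by rewrite -val_eqE/= eq_sym => /negPf ->; rewrite ?andbF.
Qed.

Section Box.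
Variable d : nat.
Implicit Types (x y z : 'rV[int]_d) (n : nat).

Definition box n : seq 'rV[int]_d :=
  [seq \row_i ((f i : nat)%:Z - n%:Z) | f : {ffun 'I_d -> 'I_(n.*2.+1)}].

Lemma boxP n x : reflect (forall i : 'I_d, (absz (x 0%R i) <= n)%N) (x \in box n).
Proof.
apply/(iffP idP) => [/mapP[f _ ->] i|xn].
  by rewrite mxE; case: (f i) => k /= kn; lia.
apply/mapP; exists [ffun i => inord (absz (x 0 i + n%:Z))]; first by rewrite mem_enum.
apply/rowP => i; rewrite mxE ffunE; move: (x 0 i) (xn i) => k kn.
rewrite inordK; lia.
Qed.

Lemma uniq_box n : uniq (box n).
Proof.
rewrite map_inj_uniq ?enum_uniq// => f g /rowP fg; apply/ffunP => i.
by have := fg i; rewrite !mxE => /(congr1 (+%R^~ n%:Z)); rewrite !subrK => -[/val_inj].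
Qed.

Lemma boxD m n x y : x \in box m -> y \in box n -> x + y \in box (m + n).
Proof.
move=> /boxP xm /boxP yn; apply/boxP => i.
by rewrite mxE; move: (x 0 i) (y 0 i) (xm i) (yn i) => a b; lia.
Qed.

Lemma box_opp n x : (- x \in box n) = (x \in box n).
Proof.
by apply/boxP/boxP => h i; have := h i; rewrite !mxE abszN.
Qed.

Lemma boxB m n x y : x \in box m -> y \in box n -> x - y \in box (m + n).
Proof. by move=> xm yn; rewrite boxD// box_opp. Qed.

Lemma box_le m n x : (m <= n)%N -> x \in box m -> x \in box n.
Proof.
move=> mn /boxP xm; apply/boxP => i.
exact: leq_trans (xm i) mn.
Qed.

Lemma box_exists (A : seq 'rV[int]_d) : exists n, {subset A <= box n}.
Proof.
elim: A => [|x A [n An]]; first by exists 0%N.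
exists (n + \sum_i `|x 0%R i|%N)%N => y; rewrite inE => /predU1P[->|/An].
  apply/boxP => i; rewrite (bigD1 i)//=; lia.
exact/box_le/leq_addr.
Qed.

(** Kronecker substitution, which packs $d$ exponents into one. On the box of radius [T] the shifted
    coordinates are nonnegative, so [absz] leaves them unchanged. *)
Definition kronecker (L T : nat) x : nat := (\sum_i absz (x 0%R i + T%:Z)%R * L ^ i)%N.

(** The digits lie between $0$ and $2T$, hence below $L$. *)
Lemma kronecker_inj L T : (T.*2 < L)%N ->
  {in box T &, injective (kronecker L T)}.
Proof.
move=> TL x y /boxP xT /boxP yT /digits_inj h.
apply/rowP => i; have xi := xT i; have yi := yT i.
suff : absz (x 0%R i + T%:Z)%R = absz (y 0%R i + T%:Z)%R.
  by move: (x 0 i) (y 0 i) xi yi => u v; lia.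
by apply: h => k; [move: (x 0 k) (xT k) | move: (y 0 k) (yT k)] => u; lia.
Qed.

Lemma kroneckerD L T T' x y : x \in box T -> y \in box T' ->
  kronecker L (T + T') (x + y) = (kronecker L T x + kronecker L T' y)%N.
Proof.
move=> /boxP xT /boxP yT; rewrite /kronecker -big_split/=; apply: eq_bigr => i _; rewrite -mulnDl mxE.
by congr (_ * _)%N; move: (x 0 i) (y 0 i) (xT i) (yT i) => a b; lia.
Qed.

End Box.

(** * Convolution as multiplication of polynomials *)

Section Embedding.
Variables (C : numClosedFieldType) (d L : nat) (j : 'I_d).
Implicit Types (x y z : 'rV[int]_d) (s A : seq 'rV[int]_d) (a b f : 'rV[int]_d -> C).

(** Indexed by the argument of [a], so that [A] can list a finite support while [b] stays
    arbitrary. *)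
Definition conv A a b z : C := \sum_(x <- A) a x * b (z - x).

(* The point [x], translated by [T] to have nonnegative coordinates, is encoded
   by its [j]-th coordinate and by all its coordinates read as base-[L] digits:
   this turns convolution on [Z^d] into the product of bivariate polynomials. *)
Definition mono T x : {poly {poly C}} :=
  ('X^(kronecker L T x))%:P * 'X^(absz (x 0 j + T%:Z)).

Definition emb T s f : {poly {poly C}} := \sum_(x <- s) (f x)%:P%:P * mono T x.

Lemma monoM T T' x y : x \in box d T -> y \in box d T' ->
  mono T x * mono T' y = mono (T + T') (x + y).
Proof.
move=> xT yT; rewrite /mono mulrACA -polyCM -!exprD kroneckerD//; congr (_ * 'X^_).
rewrite mxE; move/boxP/(_ j): xT; move/boxP/(_ j): yT.
by move: (x 0 j) (y 0 j) => u v; lia.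
Qed.

Lemma coef_emb T s f n m : (emb T s f)`_n`_m =
  \sum_(x <- s) (if (absz (x 0%R j + T%:Z)%R == n) && (kronecker L T x == m)%N then f x else 0).
Proof.
rewrite /emb !coef_sum; apply: eq_bigr => x _.
rewrite /mono !coefCM coefXn eq_sym; case: eqP => _; last by rewrite mulr0 coef0 mulr0.
by rewrite mulr1 coefXn eq_sym/=; case: eqP => _; rewrite ?mulr1 ?mulr0.
Qed.

(** Distinct points have distinct codes, so each coefficient is a single value of [f] or $0$. *)
Lemma sqn2_emb T s f : uniq s -> {in s &, injective (kronecker L T)} ->
  sqn2 (emb T s f) <= \sum_(x <- s) `|f x| ^+ 2.
Proof.
move=> us kinj; have [M PM] := size_coef_bound (emb T s f).
rewrite /sqn2; under eq_bigr do rewrite (sqnE (PM _)).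
have sq n m : `|(emb T s f)`_n`_m| ^+ 2 =
    \sum_(x <- s) (if (absz (x 0%R j + T%:Z)%R == n) && (kronecker L T x == m)%N
                   then `|f x| ^+ 2 else 0).
  rewrite coef_emb; pose P x := (absz (x 0 j + T%:Z) == n) && (kronecker L T x == m).
  have [/hasP[x xs Px]|/hasPn nP] := boolP (has P s); last first.
    rewrite !big1_seq ?normr0 ?expr0n// => x /= xs; move: (nP x xs);
      by rewrite /P => /negPf ->.
  have only y : y \in s -> P y -> y = x.
    move=> ys /andP[_ /eqP ky]; case/andP: Px => _ /eqP kx.
    by apply: kinj => //; rewrite kx.
  rewrite !(bigD1_seq x)//= -/(P x) Px !big1_seq ?addr0// => y /andP[yx ys];
    by rewrite -/(P y); case: ifP => // /(only _ ys) yE; rewrite yE eqxx in yx.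
under eq_bigr do under eq_bigr do rewrite sq.
under eq_bigr do rewrite exchange_big/=.
rewrite exchange_big/= ler_sum// => x _.
by rewrite sum_single_le ?exprn_ge0.
Qed.

(** By injectivity of the code, $f(z)$ is itself a coefficient of this row. *)
Lemma sqn_emb_ge T s f z : uniq s -> {in s &, injective (kronecker L T)} ->
  z \in s -> `|f z| ^+ 2 <= sqn (emb T s f)`_(absz (z 0 j + T%:Z)%R).
Proof.
move=> us kinj zs.
have := sum_seq_le_sqn (emb T s f)`_(absz (z 0%R j + T%:Z)%R) (s := [:: kronecker L T z]) isT.
rewrite big_seq1 coef_emb (bigD1_seq z)//= !eqxx/= big1_seq ?addr0// => y /andP[yz ys].
case: ifP => // /andP[_ /eqP /(kinj _ _ ys zs) yE]; by rewrite yE eqxx in yz.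
Qed.

(** Monomials multiply as points add. As [b] vanishes off its box, for fixed [x] only the points $z
    = x + y$ with [y] in that box contribute to the sum over the large box. *)
Lemma embM T T' A a b : {subset A <= box d T} ->
  (forall y, y \notin box d T' -> b y = 0) ->
  emb T A a * emb T' (box d T') b = emb (T + T') (box d (T + T')) (conv A a b).
Proof.
move=> AT b0; rewrite {1}/emb mulr_suml.
transitivity (\sum_(x <- A) \sum_(z <- box d (T + T'))
    (a x * b (z - x))%:P%:P * mono (T + T') z); last first.
  rewrite exchange_big; apply: eq_bigr => z _.
  by rewrite -mulr_suml -!rmorph_sum.
rewrite big_seq [RHS]big_seq; apply: eq_bigr => x /AT xT.
rewrite (@big_seq_sub _ _ [seq x + y | y <- box d T']); last 4 first.
- by rewrite map_inj_uniq ?uniq_box//; exact: addrI.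
- exact: uniq_box.
- by move=> _ /mapP[y yT ->]; exact: boxD.
- move=> z _ zs; rewrite b0 ?mulr0 ?polyC0 ?mul0r//.
  by apply: contra zs => h; apply/mapP; exists (z - x) => //; rewrite addrC subrK.
rewrite big_map mulr_sumr big_seq [RHS]big_seq; apply: eq_bigr => y yT.
by rewrite mulrACA monoM// [x + y]addrC addrK !polyCM.
Qed.

(** The Euler operator $X\,d/dX$ multiplies each monomial by its exponent, here $x_j + T \ge 0$. *)
Lemma deriv_emb T A a : {subset A <= box d T} ->
  (emb T A a)^`() * 'X = emb T A (fun x => (x 0 j + T%:Z)%:~R * a x).
Proof.
move=> AT; rewrite /emb raddf_sum mulr_suml big_seq [RHS]big_seq.
apply: eq_bigr => x /AT/boxP/(_ j) xj.
rewrite /mono; set k := absz _; have -> : x 0 j + T%:Z = k by rewrite /k; move: (x 0 j) xj => u; lia.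
rewrite /= mulrA -polyCM derivM derivC mul0r add0r derivXn -mulrA mulrnAl -exprSr.
rewrite mulrA -polyCM; case: k => [|k]/=; first by rewrite mulr0n mulr0 mul0r polyC0 !mul0r.
rewrite mulrnAr -mulrnAl; congr (_ * _).
by rewrite -pmulrn -polyCMn -mulrnAl -polyCMn -mulr_natl.
Qed.

Lemma size_emb T s f : {subset s <= box d T} -> (size (emb T s f) <= T.*2.+1)%N.
Proof.
move=> sT; apply/leq_sizeP => n Tn; apply/polyP => m; rewrite coef_emb coef0 big1_seq// => x /= /sT/boxP/(_ j) xj.
case: ifP => // /andP[/eqP xn _]; lia.
Qed.

Lemma l1n2_emb T s f : l1n2 (emb T s f) <= \sum_(x <- s) `|f x|.
Proof.
have [M PM] := size_coef_bound (emb T s f).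
rewrite /l1n2; under eq_bigr do rewrite (l1nE (PM _)).
apply: (@le_trans _ _ (\sum_(n < size (emb T s f)) \sum_(m < M) \sum_(x <- s)
   (if (absz (x 0%R j + T%:Z)%R == n) && (kronecker L T x == m)%N then `|f x| else 0))).
  apply: ler_sum => n _; apply: ler_sum => m _; rewrite coef_emb.
  apply: le_trans (ler_norm_sum _ _ _) _; apply: ler_sum => x _.
  by case: ifP => //; rewrite normr0.
under eq_bigr do rewrite exchange_big/=.
rewrite exchange_big/= ler_sum// => x _.
by rewrite sum_single_le ?exprn_ge0.
Qed.

End Embedding.

(** * Derivations of an annihilator of [b] annihilate [b] *)

Section Derivation.
Variables (C : numClosedFieldType) (d : nat).
Implicit Types (x y z : 'rV[int]_d) (A : seq 'rV[int]_d) (a b : 'rV[int]_d -> C).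

Definition height x : nat := \max_(i < d) absz (x 0%R i).

Lemma mem_box_height n x : (x \in box d n) = (height x <= n)%N.
Proof.
apply/boxP/idP => [xn|xn i]; first by apply/bigmax_leqP => i _; exact: xn.
exact: leq_trans (leq_bigmax i) xn.
Qed.

(* Equal to [N] on the box of radius [N] and to [0] outside that of radius [2N]
   (truncated subtraction). *)
Definition cutoff N x : nat := minn N (N.*2 - height x).

Lemma heightD x y : (height (x + y) <= height x + height y)%N.
Proof. by rewrite -mem_box_height boxD// mem_box_height. Qed.

Lemma heightN x : height (- x) = height x.
Proof. by rewrite /height; apply: eq_bigr => i _; rewrite mxE abszN. Qed.

(** Translation by a point of the box of radius [r] changes the height by at most [r]. *)
Lemma cutoff_lipschitz N r x z : x \in box d r ->
  `|(cutoff N (z - x))%:R - (cutoff N z)%:R : C| <= r%:R.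
Proof.
rewrite mem_box_height => xr.
have h1 : (height (z - x) <= height z + r)%N.
  by rewrite (leq_trans (heightD _ _))// heightN leq_add2l.
have h2 : (height z <= height (z - x) + r)%N.
  by rewrite -{1}(subrK x z) (leq_trans (heightD _ _))// leq_add2l.
have : (cutoff N (z - x) <= cutoff N z + r)%N by rewrite /cutoff; lia.
have : (cutoff N z <= cutoff N (z - x) + r)%N by rewrite /cutoff; lia.
rewrite -!(ler_nat C) !natrD => l1 l2.
rewrite real_ler_norml ?rpredB ?realn// lerNl opprB !lerBlDr.
by rewrite ![r%:R + _]addrC l1 l2.
Qed.

Definition mass b n : C := \sum_(y <- box d n) `|b y| ^+ 2.

Lemma mass_le b m n : (m <= n)%N -> mass b m <= mass b n.
Proof.
move=> mn; apply: ler_sum_subseq => [| | x|i]; rewrite ?uniq_box ?exprn_ge0//.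
exact: box_le.
Qed.

(** Subtracting the cutoff at [z] times $(a * b)(z) = 0$ leaves only differences of the cutoff, each
    at most [r]. The bound is therefore independent of the height $N$ of the cutoff. *)
Lemma mass_cutoff_conv A a b r N T :
  {subset A <= box d r} -> (forall z, conv A a b z = 0) ->
  \sum_(z <- box d T) `|conv A a (fun y => (cutoff N y)%:R * b y) z| ^+ 2 <=
  (size A)%:R * r%:R ^+ 2 * (\sum_(x <- A) `|a x| ^+ 2) * mass b (T + r).
Proof.
move=> Ar ab0.
have le1 z : `|conv A a (fun y => (cutoff N y)%:R * b y) z| ^+ 2 <=
    (size A)%:R * \sum_(x <- A) r%:R ^+ 2 * `|a x| ^+ 2 * `|b (z - x)| ^+ 2.
  have -> : conv A a (fun y => (cutoff N y)%:R * b y) z =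
      \sum_(x <- A) ((cutoff N (z - x))%:R - (cutoff N z)%:R) * a x * b (z - x).
    transitivity (conv A a (fun y => (cutoff N y)%:R * b y) z - (cutoff N z)%:R * conv A a b z).
      by rewrite ab0 mulr0 subr0.
    rewrite /conv mulr_sumr -sumrB.
    by apply: eq_bigr => x _; ring.
  apply: le_trans (ler_sqr_sum _ _) _; rewrite ler_wpM2l// big_seq [leRHS]big_seq.
  apply: ler_sum => x /Ar xr; rewrite !normrM !exprMn.
  rewrite ler_wpM2r ?exprn_ge0// ler_wpM2r ?exprn_ge0//.
  by rewrite lerXn2r ?nnegrE// cutoff_lipschitz.
apply: le_trans (ler_sum _ (fun z _ => le1 z)) _.
rewrite -mulr_sumr -[_ * _ ^+ 2 * _ * _]mulrA -[_ * _ ^+ 2 * _]mulrA ler_wpM2l// exchange_big/=.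
rewrite [leRHS](_ : _ = \sum_(x <- A) r%:R ^+ 2 * `|a x| ^+ 2 * mass b (T + r)); last first.
  by rewrite -mulr_suml -mulr_sumr mulrA.
rewrite big_seq [leRHS]big_seq; apply: ler_sum => x /Ar xr.
rewrite -mulr_sumr ler_wpM2l ?mulr_ge0 ?exprn_ge0//.
rewrite -(big_map (fun z => z - x) xpredT (fun y => `|b y| ^+ 2)).
apply: ler_sum_subseq => [||y|y]; rewrite ?uniq_box ?exprn_ge0//.
  by rewrite map_inj_uniq ?uniq_box//; exact: addIr.
by move=> /mapP[z zT ->]; exact: boxB.
Qed.

(** [deriv_mul_coef2] is applied to the embeddings of $a$ and of the cutoff of $b$. Near [z] the
    cutoff equals $N$, which gives $N^2$ on the left; on the right, $N^2$ bounds the squared cutoff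
    in the first term and is explicit in the second. This common factor cancels. *)
Lemma conv_derivation_bound A a b j r N z :
  uniq A -> {subset A <= box d r} -> (forall z, conv A a b z = 0) ->
  (height z + r < N)%N ->
  N%:R * `|conv A (fun x => (x 0 j + r%:Z)%:~R * a x) b z| ^+ 2 <=
  2 * r.*2.+1%:R ^+ 2 * ((r.*2.+1%:R * \sum_(x <- A) `|a x|) ^+ 2 +
    (size A)%:R * r%:R ^+ 2 * \sum_(x <- A) `|a x| ^+ 2) * mass b (N.*2 + r.*2).
Proof.
move=> uA Ar ab0 zN.
pose D x := (x 0 j + r%:Z)%:~R * a x.
(* [T] is large enough for the support of the convolution, and [L] is the least base that separates
   the codes of its box. *)
pose c y := (cutoff N y)%:R * b y; pose T := (r + N.*2)%N; pose L := T.*2.+1.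
pose Q := emb L j r A a; pose U := emb L j N.*2 (box d N.*2) c.
have kinj : {in box d T &, injective (@kronecker d L T)}.
  exact: kronecker_inj.
have c0 y : y \notin box d N.*2 -> c y = 0.
  by rewrite mem_box_height -ltnNge => h; rewrite /c /cutoff (_ : minn _ _ = 0%N) ?mul0r//; lia.
have QU : Q * U = emb L j T (box d T) (conv A a c) by exact: embM.
have DQU : Q^`() * U * 'X = emb L j T (box d T) (conv A D c).
  by rewrite mulrAC deriv_emb// embM.
have zT : z \in box d T by rewrite mem_box_height; lia.
(* The factor $X$ in [DQU] shifts exponents by one, so [n] is the exponent of [z] minus one; $N \le
   n$ since $z_j + T \ge 2N + r - N$, with room to spare. *)
have [n nE Nn] : exists2 n, absz (z 0%R j + T%:Z)%R = n.+1 & (N <= n)%N.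
  have zj : (absz (z 0%R j) <= height z)%N by exact: (leq_bigmax j).
  exists (absz (z 0 j + T%:Z)).-1; move: (z 0 j) zj => u zj; rewrite /T; lia.
(* Every $z - x$ involved has height below $N$, where the cutoff is constantly $N$. *)
have wE : N%:R * conv A D b z = conv A D c z.
  rewrite /conv mulr_sumr big_seq [RHS]big_seq; apply: eq_bigr => x /Ar.
  rewrite mem_box_height => xr; rewrite /c /cutoff (_ : minn _ _ = N); first by ring.
  have := heightD z (- x); rewrite heightN; lia.
have lo : (N%:R ^+ 2) * `|conv A D b z| ^+ 2 <= sqn (Q^`() * U)`_n.
  have := sqn_emb_ge j (conv A D c) (uniq_box d T) kinj zT.
  by rewrite -DQU nE coefMX/= -wE normrM exprMn normr_nat.
have sQ : (size Q <= r.*2.+1)%N by exact: size_emb.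
have := deriv_mul_coef2 Q U Nn.
set K := r.*2.+1; set S1 := \sum_(x <- A) `|a x|; set M := mass _ _.
set S2 := \sum_(x <- A) _.
have S10 : 0 <= S1 by rewrite sumr_ge0.
have M0 : 0 <= M by rewrite sumr_ge0// => i _; rewrite exprn_ge0.
have N0 : 0 < N%:R ^+ 2 :> C by rewrite exprn_gt0// ltr0n; lia.
have sU : sqn2 U <= N%:R ^+ 2 * M.
  apply: le_trans (sqn2_emb _ _ (uniq_box d _) _) _.
    by apply: kronecker_inj; rewrite /L /T; lia.
  apply: (@le_trans _ _ (N%:R ^+ 2 * mass b N.*2)).
    rewrite mulr_sumr ler_sum// => y _; rewrite normrM exprMn ler_wpM2r ?exprn_ge0//.
    by rewrite normr_nat lerXn2r ?nnegrE// ler_nat geq_minl.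
  by rewrite ler_wpM2l ?exprn_ge0// mass_le// leq_addr.
have sQU : sqn2 (Q * U) <= (size A)%:R * r%:R ^+ 2 * S2 * M.
  rewrite QU; apply: le_trans (sqn2_emb _ _ (uniq_box d T) kinj) _.
  have := mass_cutoff_conv N T Ar ab0; rewrite /M (_ : (T + r)%N = (N.*2 + r.*2)%N)//.
  rewrite /T; lia.
move=> up; rewrite -(ler_pM2l N0) mulrCA.
apply: le_trans (ler_wpM2l (ler0n _ _) lo) _; apply: le_trans up _.
rewrite [leRHS](_ : _ = 2 * K%:R ^+ 2 * ((K%:R * S1) ^+ 2 * (N%:R ^+ 2 * M) +
  N%:R ^+ 2 * ((size A)%:R * r%:R ^+ 2 * S2 * M))); last by ring.
have sK : (size Q)%:R <= K%:R :> C by rewrite ler_nat.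
rewrite ler_pM ?mulr_ge0 ?addr_ge0 ?mulr_ge0 ?exprn_ge0 ?mulr_ge0 ?sqn2_ge0 ?l1n2_ge0//.
  by rewrite ler_wpM2l// lerXn2r ?nnegrE.
rewrite lerD//; last by rewrite ler_wpM2l// ltW.
rewrite ler_pM ?sqn2_ge0 ?exprn_ge0 ?mulr_ge0 ?l1n2_ge0//.
rewrite lerXn2r ?nnegrE ?mulr_ge0 ?l1n2_ge0// ler_pM ?l1n2_ge0//.
exact: l1n2_emb.
Qed.

(** This $o(n)$ condition is all that the algebraic argument retains of $\beta \in L^p$ and of the
    bound on $p$. *)
Definition mass_small b :=
  forall e : C, 0 < e -> exists n0, forall n, (n0 <= n)%N -> mass b n <= e * n%:R.

Lemma conv_derivation A a b j r : uniq A -> {subset A <= box d r} ->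
  (forall z, conv A a b z = 0) -> mass_small b ->
  forall z, conv A (fun x => (x 0 j + r%:Z)%:~R * a x) b z = 0.
Proof.
move=> uA Ar ab0 small z; set w := conv _ _ _ _.
pose M : C := 2 * r.*2.+1%:R ^+ 2 * ((r.*2.+1%:R * \sum_(x <- A) `|a x|) ^+ 2 +
  (size A)%:R * r%:R ^+ 2 * \sum_(x <- A) `|a x| ^+ 2).
have M0 : 0 <= M.
  by rewrite !(mulr_ge0, addr_ge0, exprn_ge0, sumr_ge0)// => x _; rewrite exprn_ge0.
apply/eqP; apply: contraT => w0.
have w2 : 0 < `|w| ^+ 2 by rewrite exprn_gt0// normr_gt0.
(* Since $2N + 2r \le 4N$, mass at most $\varepsilon n$ with $\varepsilon = |w|^2/(4M+1)$ turns the
   bound into $N|w|^2 \le N|w|^2 \cdot 4M/(4M+1)$, which is impossible for $w \ne 0$. *)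
have M4 : 0 < 4 * M + 1 by rewrite ltr_wpDl// mulr_ge0.
have [n0 hn0] := small (`|w| ^+ 2 / (4 * M + 1)) (divr_gt0 w2 M4).
pose N := (height z + r + n0).+1.
have zN : (height z + r < N)%N by rewrite /N; lia.
have n0N : (n0 <= N.*2 + r.*2)%N by rewrite /N; lia.
have := conv_derivation_bound j uA Ar ab0 zN; rewrite -/w -/M => up.
have up2 : N%:R * `|w| ^+ 2 <= N%:R * (4 * M * (`|w| ^+ 2 / (4 * M + 1))).
  apply: le_trans up _.
  apply: le_trans (ler_wpM2l M0 (hn0 _ n0N)) _.
  apply: (@le_trans _ _ (M * (`|w| ^+ 2 / (4 * M + 1) * (4 * N)%:R))).
    rewrite ler_wpM2l// ler_wpM2l ?(ltW (divr_gt0 w2 M4))// ler_nat /N; lia.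
  by rewrite natrM le_eqVlt; apply/orP; left; apply/eqP; ring.
move: up2; rewrite ler_pM2l ?ltr0n// mulrA ler_pdivlMr// mulrDr mulr1 mulrC.
by rewrite -subr_ge0 opprD addrA subrr sub0r oppr_ge0 => /(lt_le_trans w2); rewrite ltxx.
Qed.

(** Induction on the number of points of [A]. For a single point, the convolution is a translate of
    [b] times a nonzero scalar. *)
Lemma conv_mass_small_eq0 A a b : uniq A -> A != [::] ->
  {in A, forall x, a x != 0} -> (forall z, conv A a b z = 0) -> mass_small b ->
  forall z, b z = 0.
Proof.
move=> uA A0 nz ab0 small; have [n] := ubnP (size A).
elim: n A a uA A0 nz ab0 => // n IH [|x [|y A]] // a uA _ nz ab0 szA z.
  have := ab0 (z + x); rewrite /conv big_seq1 addrK => /eqP.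
  by rewrite mulf_eq0 (negPf (nz x _)) ?mem_head//= => /eqP.
set A1 := [:: x, y & A] in uA nz ab0 szA *.
have [j xyj] : exists j, y 0 j != x 0 j.
  apply/existsP; apply: contraTT uA; rewrite negb_exists => /forallP xy.
  rewrite /A1 (_ : y = x) ?cons_uniq ?mem_head//.
  by apply/rowP => j; apply/eqP; have := xy j; rewrite negbK.
have [r Ar] := box_exists A1.
(* This is the derivation of [a] minus $(r + x_j)\,a$: it vanishes at [x] but not at [y], so the
   support shrinks and stays nonempty. *)
pose a' (w : 'rV[int]_d) : C := (w 0 j - x 0 j)%:~R * a w.
have a'x : a' x = 0 by rewrite /a' subrr mul0r.
have a'y : a' y != 0.
  by rewrite mulf_neq0 ?intr_eq0 ?subr_eq0// nz// !inE eqxx orbT.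
have a'0 w : conv A1 a' b w = 0.
  have := conv_derivation j uA Ar ab0 small w.
  move=> Dw; transitivity (conv A1 (fun x => (x 0 j + r%:Z)%:~R * a x) b w -
                (r%:Z + x 0 j)%:~R * conv A1 a b w); last by rewrite Dw ab0 mulr0 subr0.
  rewrite /conv mulr_sumr -sumrB; apply: eq_bigr => v _.
  by rewrite /a' !rmorphD/= rmorphN/=; ring.
apply: (IH [seq w <- A1 | a' w != 0] a').
- exact: filter_uniq.
- apply/eqP => A'0; have : y \in [seq w <- A1 | a' w != 0].
    by rewrite mem_filter a'y !inE eqxx orbT.
  by rewrite A'0.
- by move=> w; rewrite mem_filter => /andP[].
- move=> w; apply: etrans (a'0 w); rewrite /conv big_filter big_mkcond; apply: eq_bigr => v _.
  by case: eqVneq => // ->; rewrite mul0r.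
- move: szA; rewrite /= a'x eqxx/= => szA.
  rewrite -[if _ then _ else _]/([seq w <- y :: A | a' w != 0]) size_filter.
  by apply: leq_ltn_trans (count_size _ _) _; rewrite -ltnS.
Qed.

End Derivation.

Local Open Scope classical_set_scope.
Local Open Scope ring_scope.

(** * Growth of $L^p$ functions on boxes *)

Section Growth.
Variable R : realType.

(** [F] attains the supremum up to [e], so a list disjoint from it can add at most [e]. *)
Lemma esum_tail (T : choiceType) (u : T -> R) (e : R) :
  (forall x, 0 <= u x) -> (\esum_(x in [set: T]) (u x)%:E < +oo)%E -> 0 < e ->
  exists2 F : seq T, uniq F &
    forall s, uniq s -> (forall x, x \in s -> x \notin F) -> \sum_(x <- s) u x <= e.
Proof.
move=> u0 uoo e0.
have ub s : uniq s ->
    ((\sum_(x <- s) u x)%:E <= \esum_(x in [set: T]) (u x)%:E)%E.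
  move=> us; apply: esum_ge; exists [set` s]; first by split => //; exact: finite_seq.
  by rewrite -fsbig_seq// sumEFin.
have Sfin : (\esum_(x in [set: T]) (u x)%:E)%E \is a fin_num.
  by rewrite ge0_fin_numE// esum_ge0// => x _; rewrite lee_fin.
have [_ [X [Xfin _] <-] SX] := ub_ereal_sup_adherent e0 Sfin.
exists (finmap.enum_fset (fset_set X)) => [|s us sX]; first exact: finmap.fset_uniq.
have /ub : uniq (finmap.enum_fset (fset_set X) ++ s).
  by rewrite cat_uniq finmap.fset_uniq us andbT; apply/hasPn.
move: SX; rewrite fsbig_finite// sumEFin.
rewrite -[ereal_sup _]/(esum [set: T] (fun x => (u x)%:E)) -(fineK Sfin) big_cat/=.
by rewrite -EFinB lte_fin lee_fin; lra.
Qed.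

(** A pointwise form of the Hoelder step. If it failed, then $\sigma^d < a^2$ and $a^p \le \sigma
    a^2$; as $a \le 1$, the bound on $p$ gives $a^{2(d+1)} \le (a^p)^d \le \sigma^d a^{2d}$, so $a^2
    \le \sigma^d$. *)
Lemma sqr_le_of_powR (d : nat) (p a sigma : R) : 0 <= a -> a <= 1 -> 0 < sigma ->
  p * d%:R <= 2 * d.+1%:R ->
  a ^+ 2 <= sigma ^+ d + sigma^-1 * a `^ p.
Proof.
move=> a0 a1 s0 pd.
have v0 : 0 <= a `^ p by exact: powR_ge0.
have [->|aN0] := eqVneq a 0.
  by rewrite expr0n addr_ge0 ?exprn_ge0 ?mulr_ge0 ?invr_ge0 ?powR_ge0 ?(ltW s0).
have a_gt0 : 0 < a by rewrite lt_def aN0.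
have va : a ^+ (2 * d.+1) <= (a `^ p) ^+ d.
  by rewrite -powR_mulrn// -powR_mulrn// -powRrM ger_powR ?a_gt0// natrM.
rewrite leNgt; apply/negP => lt_a2.
have sd : sigma ^+ d < a ^+ 2.
  by rewrite (le_lt_trans _ lt_a2)// lerDl mulr_ge0 ?invr_ge0 ?(ltW s0).
have vs : a `^ p <= sigma * a ^+ 2.
  by rewrite -ler_pdivrMl// (le_trans _ (ltW lt_a2))// lerDr exprn_ge0 ?(ltW s0).
have : a ^+ (2 * d.+1) <= (sigma * a ^+ 2) ^+ d.
  by apply: le_trans va _; rewrite lerXn2r// nnegrE mulr_ge0 ?exprn_ge0 ?(ltW s0).
rewrite exprMn exprM exprS ler_pM2r ?exprn_gt0//.
by rewrite leNgt sd.
Qed.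

Lemma size_box d n : size (box d n) = (n.*2.+1 ^ d)%N.
Proof. by rewrite size_map -cardE card_ffun !card_ord. Qed.

Lemma lp_box_growth d (p : R) (b : 'rV[int]_d.+1 -> R) : (0 < d)%N ->
  0 <= p -> p * d%:R <= 2 * d.+1%:R -> (forall x, 0 <= b x) ->
  (\esum_(x in [set: 'rV[int]_d.+1]) (b x `^ p)%:E < +oo)%E ->
  forall e, 0 < e -> exists n0, forall n, (n0 <= n)%N ->
    \sum_(y <- box d.+1 n) b y ^+ 2 <= e * n%:R.
Proof.
move=> d0 p0 pd b0 boo e e0.
(* Chosen so that $t < 1$ and $12t \le e$: with $k = 2n+1 \le 3n$, the part off [F] is at most $2kt
   \le 6nt \le en/2$. *)
pose t := e / (e + 12).
have e12 : 0 < e + 12 by lra.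
have t0 : 0 < t by rewrite divr_gt0.
have te : t * 12 <= e by rewrite mulrAC ler_pdivrMr// ler_pM2l//; lra.
have t1 : t < 1 by rewrite ltr_pdivrMr//; lra.
have [F uF tail] := esum_tail (fun x => powR_ge0 (b x) p) boo (exprn_gt0 2 t0).
pose c := \sum_(y <- F) b y ^+ 2.
have c0 : 0 <= c by rewrite sumr_ge0// => y _; rewrite exprn_ge0.
(* Beyond this rank the fixed contribution [c] of [F] is at most $en/2$; the successor ensures $n
   \ge 1$. *)
exists (Num.bound (e^-1 * (2 * c))).+1 => n n0n.
have n1 : (0 < n)%N := leq_ltn_trans (leq0n _) n0n.
have cn : 2 * c <= e * n%:R.
  rewrite -ler_pdivrMl//; apply: le_trans (ltW (archi_boundP _)) _.
    by rewrite !mulr_ge0 ?invr_ge0 ?(ltW e0).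
  by rewrite ler_nat ltnW.
have inF : \sum_(y <- box d.+1 n | y \in F) b y ^+ 2 <= c.
  rewrite -big_filter; apply: ler_sum_subseq => [||y|y]; rewrite ?filter_uniq ?uniq_box ?exprn_ge0//.
  by rewrite mem_filter => /andP[].
set k : R := n.*2.+1%:R; have k0 : 0 < k by rewrite ltr0n.
have s0 : 0 < t / k by rewrite divr_gt0.
(* The powers balance: the box has [k ^ d.+1] points, each costing [(t / k) ^ d]. *)
have outF : \sum_(y <- box d.+1 n | y \notin F) b y ^+ 2 <= k * t ^+ d + k * t.
  rewrite -big_filter; set s := seq.filter _ _.
  have us : uniq s by rewrite filter_uniq ?uniq_box.
  have sF x : x \in s -> x \notin F by rewrite mem_filter => /andP[].
  have b1 x : x \in s -> b x <= 1.
    move=> xs; rewrite leNgt; apply/negP => bx1.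
    have : b x `^ p <= t ^+ 2.
      have := tail [:: x] isT; rewrite big_seq1; apply => y.
      by rewrite inE => /eqP ->; exact: sF.
    apply/negP; rewrite -ltNge; apply: (@lt_le_trans _ _ 1).
      by rewrite expr_lt1 ?(ltW t0).
    by have := ler_powR (ltW bx1) p0; rewrite powRr0.
  apply: (@le_trans _ _ (\sum_(y <- s) ((t / k) ^+ d + (t / k)^-1 * b y `^ p))).
    rewrite big_seq [leRHS]big_seq; apply: ler_sum => y ys.
    exact: sqr_le_of_powR (b0 y) (b1 y ys) s0 pd.
  rewrite big_split/= -mulr_sumr lerD//.
    rewrite big_const_seq count_predT iter_addr_0.
    apply: (@le_trans _ _ ((t / k) ^+ d *+ (n.*2.+1 ^ d.+1))).
      by rewrite ler_wpMn2l ?exprn_ge0 ?ltW// -size_box size_filter count_size.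
    by rewrite -mulr_natr natrX -/k expr_div_n exprS mulrCA divfK// expf_neq0 ?gt_eqF.
  rewrite mulrC -ler_pdivlMr ?invr_gt0// (le_trans (tail s us sF))//.
  by rewrite invrK [leRHS](_ : _ = t ^+ 2)//; field; rewrite gt_eqF.
rewrite (bigID [in F])/= (le_trans (lerD inF outF))//.
have td : t ^+ d <= t.
  by rewrite -[leRHS]expr1 ler_wiXn2l // ltW.
have h1 : k * t ^+ d <= k * t by rewrite ler_pM2l.
have kn : k <= 3 * n%:R by rewrite /k -natrM ler_nat; clear -n1; lia.
have h2 : k * t <= 3 * n%:R * t by rewrite ler_pM2r.
have h3 : n%:R * (t * 12) <= n%:R * e by rewrite ler_wpM2l.
clear -cn h1 h2 h3; lra.
Qed.

End Growth.

(** * From $L^p$ functions and convolution on the whole group to finite lists and boxes *)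

Theorem theorem2p1 (R : realType) (d : nat) (p : R)
    (alpha beta : 'rV[int]_d -> R[i]) :
  (2 <= d)%N -> 1 <= p ->
  group_algebra alpha -> alpha <> cst 0 ->
  Lp p beta -> beta <> cst 0 ->
  p <= 2 * d%:R / (d%:R - 1) ->
  convol alpha beta <> cst 0.
Proof.
case: d alpha beta => [|d]// alpha beta d1 p1 fa a0 bLp b0 pd ab0.
apply: b0; apply/funext => z.
have d0 : 0 < d%:R :> R by rewrite ltr0n.
have {}pd : p * d%:R <= 2 * d.+1%:R.
  by move: pd; rewrite -[X in _ / (X - 1)]natr1 addrK ler_pdivlMr.
pose A := finmap.enum_fset (fset_set [set g | alpha g != 0]).
have inA x : (x \in A) = (alpha x != 0).
  by apply/idP/idP; rewrite (in_fset_set fa) in_setE.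
have uA : uniq A by exact: finmap.fset_uniq.
have normc0 x : 0 <= ComplexField.Normc.normc (beta x) by case: (beta x) => u v; exact: sqrtr_ge0.
have small : mass_small beta.
  (* [mass_small] quantifies over positive elements of [R[i]]; these are real, so the growth bound
     is used with their real part. *)
  move=> e e0; have eE : e = (complex.Re e)%:C%C by rewrite RRe_real// gtr0_real.
  have re0 : 0 < complex.Re e by rewrite -ltcR -eE.
  have [n0 hn0] := lp_box_growth d1 (le_trans ler01 p1) pd
    normc0 bLp re0.
  exists n0 => n /hn0; rewrite -lecR rmorph_sum/= rmorphM/= rmorph_nat -eE.
  by congr (_ <= _); apply: eq_bigr => y _; rewrite rmorphXn.
apply: (conv_mass_small_eq0 uA _ _ _ small (a := alpha)).
- apply/eqP => A0; apply: a0; apply/funext => x; apply/eqP.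
  by have := inA x; rewrite A0 in_nil => /esym/negbFE.
- by move=> x; rewrite inA.
move=> w; have := congr1 (@^~ w) ab0; rewrite /convol/= => <-.
(* The terms with $w - h$ outside the support of [alpha] vanish, so $h$ may be restricted to the
   points $w - x$ with $x$ in [A]. *)
rewrite (@fsbigE _ _ _ _ _ [seq w - x | x <- A])//; last 2 first.
- by rewrite map_inj_uniq//; move=> x y /addrI/oppr_inj.
- move=> h _ hA; apply/eqP; rewrite mulf_eq0; apply/orP; left.
  apply: contraNT hA; rewrite -inA => hA; apply/mapP; exists (w - h) => //.
  by rewrite subKr.
rewrite big_map; under [RHS]eq_bigl do rewrite in_setT.
by apply: eq_bigr => x _; rewrite subKr.
Qed.
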